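(* Assume that $(n-1)(k-1)>2$ and that $F_{k,n}$ is neither trigonal nor (isomorphic to) a plane quintic. Let $d\geq 1$ and $(h_1,\mathbf{h})\in(\mathbb{Z}/k\mathbb{Z})^n$. The multiplicity $\mu_{d,(h_1,\mathbf{h})}$ of the irreducible representation $\chi_{(h_1,\mathbf{h})}$ of $H$ in the decomposition of the degree-$d$ piece $S_d$ of $S={\rm Sym}(V_1)$ into a direct sum of irreducible representations is $$\mu_{d,(h_1,\mathbf{h})}=\sum_{(r,\mathbf{a})\in J^{(d)}_{h_1,\mathbf{h}}}\dim_K\left(S_{d,r,\mathbf{a}}\right),$$ where $$J^{(d)}_{h_1,\mathbf{h}}=\left\{(r,\mathbf{a})\in d\cdot I_{k,n}^{(1)}:\ (r+d,-\mathbf{a})\equiv(h_1,\mathbf{h})\ {\rm mod}\ k\right\}.$$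
   Context: $K$ is an algebraically closed field of characteristic $p\geq 0$, and $k,n\geq 2$ are integers with $p\nmid k$ (no condition on $k$ when $p=0$). Fix $\lambda_1=1$ and pairwise distinct $\lambda_2,\ldots,\lambda_{n-1}\in K\setminus\{0,1\}$. The generalized Fermat curve $F_{k,n}$ of type $(k,n)$ is the smooth projective curve in $\mathbb{P}^n_K$ (homogeneous coordinates $X_0,\ldots,X_n$) defined by $$\lambda_iX_0^k+X_1^k+X_{i+1}^k=0,\qquad 1\leq i\leq n-1.$$ Set $x=X_1/X_0$ and $y_i=X_i/X_0$ for $2\leq i\leq n$. $\Omega_{F_{k,n}}$ is the canonical sheaf. For $\mathbf{a}=(a_2,\ldots,a_n)\in\mathbb{Z}^{n-1}$ write $|\mathbf{a}|=\sum_{i=2}^n a_i$. Let $$I_{k,n}^{(1)}=\left\{(r,\mathbf{a})\in\mathbb{Z}^n:\ 0\leq a_j\leq k-1\text{ for }2\leq j\leq n,\ 0\leq r\leq|\mathbf{a}|-2\right\}.$$ The differentials $\theta^{(1)}_{r,\mathbf{a}}=\dfrac{x^r dx}{y_2^{a_2}\cdots y_n^{a_n}}$, $(r,\mathbf{a})\in I_{k,n}^{(1)}$, form a $K$-basis of $V_1=H^0(F_{k,n},\Omega_{F_{k,n}})$. $S={\rm Sym}(V_1)$ is identified with the polynomial ring over $K$ in the variables $\{z_{r,\mathbf{a}}:(r,\mathbf{a})\in I_{k,n}^{(1)}\}$ ($z_{r,\mathbf{a}}$ corresponding to $\theta^{(1)}_{r,\mathbf{a}}$), with its standard grading. Fix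 a primitive $k$-th root of unity $\zeta\in K$. The group $H\cong(\mathbb{Z}/k\mathbb{Z})^n$ consists of the automorphisms $\sigma_{(e_1,\mathbf{e})}$, $(e_1,\mathbf{e})=(e_1,e_2,\ldots,e_n)\in(\mathbb{Z}/k\mathbb{Z})^n$, acting by $x\mapsto\zeta^{e_1}x$, $y_j\mapsto\zeta^{e_j}y_j$ $(2\leq j\leq n)$. It acts on $V_1$ by substitution, i.e. $\sigma_{(e_1,\mathbf{e})}z_{r,\mathbf{a}}=\zeta^{e_1(r+1)-\mathbf{a}\cdot\mathbf{e}}z_{r,\mathbf{a}}$ with $\mathbf{a}\cdot\mathbf{e}=\sum_{j=2}^n a_je_j$, and this extends to an action on $S$ by graded $K$-algebra automorphisms. The irreducible characters of $H$ are $\chi_{(h_1,\mathbf{h})}:\sigma_{(e_1,\mathbf{e})}\mapsto\zeta^{h_1e_1+\mathbf{h}\cdot\mathbf{e}}$. For $d\geq1$, $d\cdot I_{k,n}^{(1)}$ is the $d$-fold Minkowski sum $I_{k,n}^{(1)}+\cdots+I_{k,n}^{(1)}$ in $\mathbb{Z}^n$. For $(r,\mathbf{a})\in d\cdot I_{k,n}^{(1)}$, $S_{d,r,\mathbf{a}}$ is the $K$-span of the degree-$d$ monomials $z_{r_1,\mathbf{a}_1}z_{r_2,\mathbf{a}_2}\cdots z_{r_d,\mathbf{a}_d}$ with $\sum_{i=1}^d(r_i,\mathbf{a}_i)=(r,\mathbf{a})$. *)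

(* Defs.v *)
From HB Require Import structures.
From mathcomp Require Import all_boot all_order all_algebra.
From mathcomp Require Import all_fingroup all_character.
From mathcomp Require Import finmap boolp mpoly zify.

Set Implicit Arguments.
Unset Strict Implicit.
Unset Printing Implicit Defensive.

Import Order.TTheory GRing.Theory Num.Theory.

Local Open Scope ring_scope.

(* Projective varieties over K (to be used for K algebraically closed) are
   sets of K-points, given by homogeneous coordinate vectors. *)
Section ProjectiveGeometry.

Variable K : fieldType.

Definition hcoord (n : nat) := 'I_n.+1 -> K.

Definition is_point n (x : hcoord n) : Prop := exists i, x i != 0.

Definition same_point n (x y : hcoord n) : Prop :=
  exists2 c : K, c != 0 & forall i, y i = c * x i.

Definition eval_form n m (g : 'I_m.+1 -> {mpoly K[n.+1]}) (x : hcoord n) :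
  hcoord m := fun j => (g j).@[x].

(* Everywhere on X, phi is locally given by forms of equal degree without
   common zero.  This forces phi to be compatible with same_point on X. *)
Definition regular_on n m (X : hcoord n -> Prop) (phi : hcoord n -> hcoord m) :
    Prop :=
  forall x, X x -> exists (e : nat) (g : 'I_m.+1 -> {mpoly K[n.+1]}),
    [/\ forall j, g j \is e.-homog,
        is_point (eval_form g x)
      & forall x', X x' -> is_point (eval_form g x') ->
          same_point (eval_form g x') (phi x')].

Definition variety_morphism n m (X : hcoord n -> Prop) (Y : hcoord m -> Prop)
    (phi : hcoord n -> hcoord m) : Prop :=
  (forall x, X x -> Y (phi x)) /\ regular_on X phi.

Definition isomorphic n m (X : hcoord n -> Prop) (Y : hcoord m -> Prop) :
    Prop :=
  exists (phi : hcoord n -> hcoord m) (psi : hcoord m -> hcoord n),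
    [/\ variety_morphism X Y phi, variety_morphism Y X psi,
        forall x, X x -> same_point x (psi (phi x))
      & forall y, Y y -> same_point y (phi (psi y))].

Definition projective_line : hcoord 1 -> Prop := @is_point 1.

(* Representatives of elements of the function field K(X), X irreducible:
   quotients of forms of equal degree, the denominator not vanishing
   identically on X. *)
Record ratfun n (X : hcoord n -> Prop) := RatFun {
  rf_deg : nat;
  rf_num : {mpoly K[n.+1]};
  rf_den : {mpoly K[n.+1]};
  rf_num_homog : rf_num \is rf_deg.-homog;
  rf_den_homog : rf_den \is rf_deg.-homog;
  rf_den_neq0 : exists2 x, X x & rf_den.@[x] != 0
}.

Definition rf_nonzero n (X : hcoord n -> Prop) (f : ratfun X) : Prop :=
  exists2 x, X x & (rf_num f).@[x] != 0.

Definition rf_defined n (X : hcoord n -> Prop) (f : ratfun X) (x : hcoord n) :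
  bool := (rf_den f).@[x] != 0.

Definition rf_val n (X : hcoord n -> Prop) (f : ratfun X) (x : hcoord n) : K :=
  (rf_num f).@[x] / (rf_den f).@[x].

(* h_0, ..., h_(m-1) in K(X) are linearly dependent over phi^* K(P^1); an
   identity in K(X) is tested wherever its terms are all defined. *)
Definition dependent_over_pullback n (X : hcoord n -> Prop)
    (phi : hcoord n -> hcoord 1) m (h : 'I_m -> ratfun X) : Prop :=
  exists c : 'I_m -> ratfun projective_line,
    (exists j, rf_nonzero (c j)) /\
    forall x, X x ->
      (forall j, rf_defined (h j) x && rf_defined (c j) (phi x)) ->
      \sum_j rf_val (c j) (phi x) * rf_val (h j) x = 0.

(* [K(X) : phi^* K(P^1)] = m.  For a constant phi this only holds with m = 0:
   a coefficient c j whose denominator vanishes at the value of phi makes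
   the identity vacuous. *)
Definition has_degree n (X : hcoord n -> Prop) (phi : hcoord n -> hcoord 1)
    (m : nat) : Prop :=
  (exists h : 'I_m -> ratfun X, ~ dependent_over_pullback phi h) /\
  (forall h : 'I_m.+1 -> ratfun X, dependent_over_pullback phi h).

(* There is a morphism of degree 3 onto the projective line. *)
Definition trigonal n (X : hcoord n -> Prop) : Prop :=
  exists phi : hcoord n -> hcoord 1,
    variety_morphism X projective_line phi /\ has_degree X phi 3.

Definition plane_curve (G : {mpoly K[3]}) (x : hcoord 2) : Prop :=
  is_point x /\ G.@[x] = 0.

Definition smooth_form (G : {mpoly K[3]}) : Prop :=
  forall x : hcoord 2, plane_curve G x -> exists i, (mderiv i G).@[x] != 0.

Definition plane_quintic n (X : hcoord n -> Prop) : Prop :=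
  exists G : {mpoly K[3]},
    [/\ G \is 5.-homog, smooth_form G & isomorphic X (plane_curve G)].

(* lam is indexed as lambda_1, ..., lambda_(n-1); its other values are not
   used. *)
Definition fermat_form (k n : nat) (lam : nat -> K) (i : nat) :
    {mpoly K[n.+1]} :=
  lam i *: 'X_(inord 0) ^+ k + 'X_(inord 1) ^+ k + 'X_(inord i.+1) ^+ k.

Definition fermat_curve (k n : nat) (lam : nat -> K) (x : hcoord n) : Prop :=
  is_point x /\
  forall i : nat, (1 <= i <= n.-1)%N -> (fermat_form k n lam i).@[x] = 0.

End ProjectiveGeometry.

Arguments fermat_curve {K} k n lam x.

(* A point (r, a) of Z^n; the entry a_j of the mathematical indexing
   j = 2, ..., n is the entry of index j - 2 of the row vector. *)
Definition lattice (n : nat) := (int * 'rV[int]_n.-1)%type.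

Section Weights.

Variables k n : nat.

Definition asum (a : 'rV[int]_n.-1) : int := \sum_j a 0 j.

Definition in_I1 (v : lattice n) : bool :=
  [forall j, 0 <= v.2 0 j <= k%:Z - 1] && (0 <= v.1 <= asum v.2 - 2%:Z).

Definition box_point (u : 'I_(n * k) * 'rV['I_k]_n.-1) : lattice n :=
  ((nat_of_ord u.1)%:Z, map_mx (fun i : 'I_k => (nat_of_ord i)%:Z) u.2).

(* The box only serves to make I1 a finite set; see mem_I1. *)
Definition I1 : {fset lattice n} :=
  [fset v in [fset box_point u | u in {: 'I_(n * k) * 'rV['I_k]_n.-1}]
     | in_I1 v]%fset.

Lemma mem_I1 v : (v \in I1) = in_I1 v.
Proof.
rewrite !inE /= andb_idl // => /andP[/forallP ha /andP[r0 rle]].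
case: v ha r0 rle => r a /= ha r0 rle.
have ltk (j : 'I_n.-1) : (`|a ord0 j| < k)%N.
  have /andP[a0 ak] := ha j.
  by rewrite -ltz_nat gez0_abs // (le_lt_trans ak) // ltrBlDr ltrDl.
have ltr : (`|r| < n * k)%N.
  have has: asum a <= (n.-1 * k)%N.
    rewrite /asum; apply: (@le_trans _ _ (\sum_(j < n.-1) k%:Z)).
      by apply: ler_sum => j _; have /andP[_ h] := ha j; lia.
    by rewrite sumr_const card_ord -mulr_natl natz PoszM.
  nia.
apply/imfsetP; exists (Ordinal ltr, \matrix_(i, j) Ordinal (ltk j)) => //=.
rewrite /box_point /=; congr pair; first by rewrite gez0_abs.
apply/rowP=> j; rewrite !mxE /= gez0_abs //.
by have /andP[] := ha j.
Qed.

Definition minkowski (A B : {fset lattice n}) : {fset lattice n} :=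
  [fset (u + v)%R | u in A, v in B]%fset.

Definition dI1 (d : nat) : {fset lattice n} :=
  iter d (minkowski I1) [fset 0]%fset.

Definition J (d : nat) (h : 'Z_k * 'rV['Z_k]_n.-1) : {fset lattice n} :=
  [fset v in dI1 d | ((v.1 + d%:Z)%:~R == h.1) &&
                     [forall j, (- v.2 0 j)%:~R == h.2 0 j]]%fset.

End Weights.

(* The library makes dhomog a vectType only for a number of variables of the
   form n.+1; homog_part is one for every number of variables. *)
Definition homog_part (N : nat) (K : fieldType) (d : nat) := dhomog N K d.

HB.instance Definition _ N (K : fieldType) d :=
  GRing.Lmodule.on (homog_part N K d).

Definition homog_part_dim (N d : nat) : nat :=
  if N is m.+1 then 'C(d + m, d) else (d == 0).

Lemma homog_part_vecaxiom N (K : fieldType) d :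
  Vector.axiom (homog_part_dim N d) (homog_part N K d).
Proof.
case: N => [|m]; last exact: dhomog_vecaxiom.
have mE (m : 'X_{1..0}) : m = 0%MM by apply/mnmP; case.
rewrite /homog_part_dim; case: (d =P 0) => [-> | /eqP d_neq0] /=.
  exists (fun p : dhomog 0 K 0 => \row__ (p : {mpoly K[0]})@_0%MM).
    by move=> c p q; apply/rowP=> i; rewrite !mxE /= mcoeffD mcoeffZ.
  have homC (r : 'rV[K]_1) : (r 0 0)%:MP_[0] \is 0.-homog.
    by apply/dhomogP=> m _; rewrite (mE m); exact: mdeg0.
  exists (fun r => DHomog (homC r)) => [p | r].
    apply/val_inj/mpolyP=> m /=.
    by rewrite !mxE mcoeffC (mE m) eqxx mulr1.
  by apply/rowP=> i; rewrite mxE /= mcoeffC eqxx mulr1 ord1.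
exists (fun=> 0) => [c p q|]; first by rewrite scaler0 addr0.
exists (fun=> 0) => [p | r]; last by apply/rowP; case.
apply/val_inj/mpolyP=> m /=; rewrite mcoeff0.
rewrite (@dhomog_nemf_coeff _ _ mdeg d p m) ?dhomog_is_dhomog //.
by rewrite (mE m) [X in X != _]mdeg0 eq_sym.
Qed.

HB.instance Definition _ N (K : fieldType) d :=
  Lmodule_hasFinDim.Build K (homog_part N K d) (homog_part_vecaxiom N K d).

Section SymmetricAlgebra.

Variables (K : fieldType) (k n : nat).

Definition nvars : nat := #|{: I1 k n}|.

(* Sym(V_1), V_1 = H^0(F, Omega_F), is the polynomial ring
   {mpoly K[nvars]}, where 'X_i is the variable z_(r, a), (r, a) = wt i,
   corresponding to the basis element x^r dx / (y_2^(a_2) ... y_n^(a_n)). *)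
Definition wt (i : 'I_nvars) : lattice n := fsval (enum_val i).

Definition S_ (d : nat) := homog_part nvars K d.

Lemma zprod_homog d (t : {ffun 'I_d -> 'I_nvars}) :
  \prod_i 'X_(t i) \is [in K[nvars], d.-homog].
Proof.
rewrite (_ : \prod_i _ = 'X_[\sum_i U_(t i)]) ?mpolyX_prod; last first.
  by elim/big_ind2: _ => [|x p y q -> ->|//]; rewrite ?mpolyX0 ?mpolyXD.
rewrite dhomogX /= mdeg_sum; under eq_bigr do rewrite mdeg1.
by rewrite sum1_card card_ord.
Qed.

Definition zprod d (t : {ffun 'I_d -> 'I_nvars}) : S_ d := DHomog (zprod_homog t).

Definition S_weight (d : nat) (v : lattice n) : {vspace S_ d} :=
  span [seq zprod t | t in [set t : {ffun 'I_d -> 'I_nvars}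
                              | \sum_i wt (t i) == v]].

End SymmetricAlgebra.

Section Action.

Variables (K : fieldType) (k n : nat) (zeta : K).

(* The additive group (Z/k)^n; (e_1, e) stands for sigma_(e_1, e).  For
   k >= 2, 'Z_k is Z/k. *)
Definition Hgroup := ('Z_k * 'rV['Z_k]_n.-1)%type.

Definition dotk (a b : 'rV['Z_k]_n.-1) : 'Z_k := \sum_j a 0 j * b 0 j.

Definition zpow (x : 'Z_k) : K := zeta ^+ x.

(* Substituting x -> zeta^(e_1) x, y_j -> zeta^(e_j) y_j multiplies the
   differential x^r dx / (y_2^(a_2) ... y_n^(a_n)) by this factor. *)
Definition sigma_coef (e : Hgroup) (v : lattice n) : K :=
  zpow (e.1 * (v.1 + 1)%:~R - dotk (map_mx intr v.2) e.2).

Definition sigma (e : Hgroup) (p : {mpoly K[nvars k n]}) :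
    {mpoly K[nvars k n]} :=
  p \mPo [tuple sigma_coef e (wt i) *: 'X_i | i < nvars k n].

Definition chi (h e : Hgroup) : K := zpow (h.1 * e.1 + dotk h.2 e.2).

Lemma mcoeff_sigma e p m :
  (sigma e p)@_m = (\prod_i sigma_coef e (wt i) ^+ m i) * p@_m.
Proof.
rewrite /sigma comp_mpolyE raddf_sum /=.
under eq_bigr => m' _.
  rewrite mcoeffZ (_ : \prod_(i < _) _ =
    (\prod_i sigma_coef e (wt i) ^+ m' i) *: 'X_[m']); last first.
    rewrite mpolyXE_id -scaler_prod; apply: eq_bigr => i _.
    by rewrite tnth_mktuple exprZn.
  rewrite mcoeffZ mcoeffX.
  over.
have [mp | mp] := boolP (m \in msupp p).
  rewrite (bigD1_seq m) //= eqxx mulr1 [X in _ + X]big1 ?addr0 1?mulrC // => m' /negPf ->.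
  by rewrite !mulr0.
rewrite (memN_msupp_eq0 mp) mulr0 big_seq big1 // => m' m'p.
case: eqP => [m'm | _]; last by rewrite !mulr0.
by rewrite -m'm m'p in mp.
Qed.

Lemma sigma_homog d e (p : S_ K k n d) : sigma e (val p) \is d.-homog.
Proof.
apply/dhomogP=> m; rewrite mcoeff_msupp mcoeff_sigma mulf_eq0 negb_or.
case/andP=> _; rewrite -mcoeff_msupp; apply: dhomog_mf.
exact: dhomog_is_dhomog.
Qed.

Definition sigma_deg d (e : Hgroup) (p : S_ K k n d) : S_ K k n d :=
  DHomog (sigma_homog e p).

Lemma sigma_deg_linear d e : linear (@sigma_deg d e).
Proof. by move=> c p q; apply/val_inj; rewrite /= /sigma linearP. Qed.

HB.instance Definition _ d e := GRing.isLinear.Build K (S_ K k n d) (S_ K k n d)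
  *:%R (@sigma_deg d e) (@sigma_deg_linear d e).

Hypotheses (hk : (1 < k)%N) (hzeta : k.-primitive_root zeta).

Lemma zpowD x y : zpow (x + y) = zpow x * zpow y.
Proof.
rewrite /zpow -exprD -(prim_expr_mod hzeta (x + y)) /=.
by congr (_ ^+ (_ %% _)); rewrite Zp_cast.
Qed.

Lemma dotkDr a b c : dotk a (b + c) = dotk a b + dotk a c.
Proof.
by rewrite -big_split; apply: eq_bigr => j _; rewrite !mxE mulrDr.
Qed.

Lemma dotk0r a : dotk a 0 = 0.
Proof. by apply: big1 => j _; rewrite mxE mulr0. Qed.

Lemma chi0 h : chi h 0 = 1.
Proof. by rewrite /chi /= dotk0r mulr0 addr0. Qed.

Lemma chiD h e f : chi h (e + f) = chi h e * chi h f.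
Proof. by rewrite /chi -zpowD /= dotkDr mulrDr addrACA. Qed.

Lemma chi_repr_subproof h :
  mx_repr [set: Hgroup] (fun e => (chi h e)%:M : 'M[K]_1).
Proof.
by split=> [|e f _ _]; rewrite ?chi0 // chiD scalar_mxM.
Qed.

Definition chi_repr h : mx_representation K [set: Hgroup] 1 :=
  MxRepresentation (chi_repr_subproof h).

Lemma sigma_coef0 v : sigma_coef 0 v = 1.
Proof. by rewrite /sigma_coef /= dotk0r mul0r subr0. Qed.

Lemma sigma_coefD e f v :
  sigma_coef (e + f) v = sigma_coef e v * sigma_coef f v.
Proof.
by rewrite /sigma_coef -zpowD /= dotkDr mulrDl opprD addrACA.
Qed.

Lemma S_repr_subproof d (b := vbasis {: S_ K k n d}) :
  mx_repr [set: Hgroup] (fun e => passmx.mxof b b (linfun (@sigma_deg d e))).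
Proof.
have bP : basis_of {: S_ K k n d} b by exact: vbasisP.
split=> [|e f _ _].
  rewrite -(passmx.mxof1 (basis_free bP)); congr (passmx.mxof b b).
  apply/lfunP=> p; rewrite lfunE id_lfunE; apply/val_inj/mpolyP=> m /=.
  rewrite mcoeff_sigma big1 ?mul1r // => i _.
  by rewrite sigma_coef0 expr1n.
rewrite -passmx.mxof_comp //; congr (passmx.mxof b b).
apply/lfunP=> p; rewrite comp_lfunE !lfunE; apply/val_inj/mpolyP=> m /=.
rewrite !mcoeff_sigma mulrA; congr (_ * _).
rewrite -big_split; apply: eq_bigr => i _ /=.
by rewrite -exprMn mulrC sigma_coefD.
Qed.

Definition S_repr d :
    mx_representation K [set: Hgroup] (\dim {: S_ K k n d}) :=
  MxRepresentation (S_repr_subproof d).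

End Action.

Section Multiplicity.

Variables (F : fieldType) (gT : finGroupType) (G : {group gT}) (m1 m2 : nat).
Variables (rG : mx_representation F G m1) (rH : mx_representation F G m2).

Definition count_similar (I : finType) (U : I -> 'M[F]_m1)
    (simU : forall i, mxsimple rG (U i)) : nat :=
  #|[pred i | `[< mx_rsim (submod_repr (mxsimple_module (simU i))) rH >]]|.

(* rG is a direct sum of irreducible subrepresentations, and in each such
   decomposition exactly mu of the summands are isomorphic to rH. *)
Definition has_multiplicity (mu : nat) : Prop :=
  inhabited (mxsemisimple rG 1%:M) /\
  forall (I : finType) (U : I -> 'M[F]_m1)
      (simU : forall i, mxsimple rG (U i)),
    (\sum_i U i :=: 1%:M)%MS -> mxdirect (\sum_i U i) ->
    count_similar simU = mu.

End Multiplicity.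

(* Main.v *)
Require Import Defs.
From mathcomp Require Import all_boot all_order all_algebra.
From mathcomp Require Import all_fingroup all_character.
From mathcomp Require Import finmap boolp mpoly.

Set Implicit Arguments.
Unset Strict Implicit.
Unset Printing Implicit Defensive.

Import GRing.Theory passmx.
Local Open Scope ring_scope.

(** The variables of S are eigenvectors of H, hence so is every monomial: a
    degree-d monomial of total weight (r, a) is multiplied by the character
    chi_(r + d, -a), because each of its d factors contributes r_i + 1 to the
    first exponent (sigma_monomial).  Thus S_d has a basis of common
    eigenvectors of H.

    In a representation with a basis of common eigenvectors, the multiplicity
    of a character chi is the number of basis vectors on which the group acts
    by chi (eigenbasis_multiplicity).  The multiplicity has to be computed in
    an arbitrary decomposition into simple submodules U_i, which need not be
    spanned by basis vectors.  The link is the chi-eigenspace W, which does not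
    depend on the decomposition.  Its dimension is the number of basis vectors
    with character chi (rank_eigenspan).  On the other hand, since the sum of
    the U_i is direct and stable, the components of an eigenvector in the U_i
    are again eigenvectors for chi; by simplicity W is therefore the sum of
    those U_i that it contains, and these are exactly the lines isomorphic to
    chi.

    It follows that the multiplicity of chi_h in S_d is the number of
    degree-d monomials whose weight (r, a) satisfies (r + d, -a) = h modulo k;
    here a primitive root of unity zeta separates the characters (chi_inj).
    Distinct monomials being linearly independent, dim S_(d, r, a) is the
    number of monomials of weight (r, a), and sorting the monomials by weight
    gives the announced sum (sum_dim_J). *)

(** * Direct sums and changes of basis *)

Lemma rank_mxdirect_subsum (F : fieldType) (m : nat) (I : finType)
    (U : I -> 'M[F]_m) (P : pred I) :
  mxdirect (\sum_i U i) ->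
  (\rank (\sum_(i | P i) U i)%MS = \sum_(i | P i) \rank (U i))%N.
Proof.
move=> /mxdirect_sumsP dU; apply/mxdirectP/mxdirect_sumsP => i Pi /=.
apply/eqP; rewrite -submx0 -[X in (_ <= X)%MS](dU i isT) capmxS //.
apply/sumsmx_subP => j /andP[_ ji].
by rewrite (sumsmx_sup j).
Qed.

(** Uniqueness of components in a direct sum, in the form used to show that the
    components of an eigenvector are eigenvectors. *)
Lemma mxdirect_sum_eq0 (F : fieldType) (m : nat) (I : finType)
    (U : I -> 'M[F]_m) (w : I -> 'rV_m) :
  mxdirect (\sum_i U i) -> (forall i, w i <= U i)%MS ->
  \sum_i w i = 0 -> forall i, w i = 0.
Proof.
move=> /mxdirect_sumsP dU wU w0 i; apply/eqP.
rewrite -submx0 -[X in (_ <= X)%MS](dU i isT) sub_capmx wU /=.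
move: w0; rewrite (bigD1 i) //= => /eqP; rewrite addr_eq0 => /eqP ->.
by rewrite eqmx_opp summx_sub_sums.
Qed.

Lemma basis_matrix_unit (F : fieldType) (vT : vectType F)
    (b X : (\dim {:vT}).-tuple vT) :
  basis_of {:vT} b -> basis_of {:vT} X ->
  \matrix_i rVof b X`_i \in unitmx.
Proof.
move=> bP XP; rewrite -row_free_unit; apply: inj_row_free => u.
rewrite mulmx_sum_row => u0; apply/rowP => i; rewrite [RHS]mxE.
move: i; apply: (freeP (basis_free XP)).
apply/eqP; rewrite -(rVof_eq0 bP) linear_sum -[X in _ == X]u0 /=.
by apply/eqP/eq_bigr => i _; rewrite linearZ rowK.
Qed.

(** * Multiplicities in the presence of an eigenbasis *)

Section EigenbasisMultiplicity.

Variables (F : fieldType) (gT : finGroupType) (G : {group gT}) (m : nat).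
Variable rG : mx_representation F G m.
Variables (B : 'M[F]_m) (c : 'I_m -> gT -> F).
Hypothesis B_unit : B \in unitmx.
Hypothesis B_eigen : forall i,
  {in G, forall g, row i B *m rG g = c i g *: row i B}.

Lemma rank_row_eigenbasis i : \rank (row i B) = 1%N.
Proof.
rewrite rank_rV; case: eqP => // Bi0.
have := congr1 (mulmx^~ (invmx B)) Bi0.
rewrite /= -row_mul mulmxV // mul0mx => /rowP/(_ i)/eqP.
by rewrite !mxE eqxx oner_eq0.
Qed.

Lemma sum_row_eigenbasis : (\sum_i <<row i B>> :=: 1%:M)%MS.
Proof.
apply/eqmxP; rewrite submx1 /= -(mulVmx B_unit); apply/row_subP => i.
rewrite row_mul mulmx_sum_row summx_sub // => j _.
by rewrite scalemx_sub // (sumsmx_sup j) // genmxE.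
Qed.

Lemma mxdirect_row_eigenbasis : mxdirect (\sum_i <<row i B>>)%MS.
Proof.
rewrite mxdirectE /= sum_row_eigenbasis mxrank1.
under eq_bigr do rewrite genmxE rank_row_eigenbasis.
by rewrite sum1_card card_ord.
Qed.

Lemma eigenbasis_semisimple : mxsemisimple rG 1%:M.
Proof.
apply: (@MxSemisimple _ _ _ _ _ _ 'I_m (fun i => <<row i B>>%MS)).
- move=> i; apply: linear_mxsimple; last first.
    by rewrite genmxE rank_row_eigenbasis.
  apply/mxmoduleP => g gG; rewrite (eqmxMr _ (genmxE _)) genmxE.
  by rewrite B_eigen // scalemx_sub.
- exact: sum_row_eigenbasis.
exact: mxdirect_row_eigenbasis.
Qed.

Variable rH : mx_representation F G 1.

Definition same_char : pred 'I_m :=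
  [pred i | `[< {in G, forall g, c i g = rH g 0 0} >]].

Definition eigenspan : 'M[F]_m := (\sum_(i | same_char i) <<row i B>>)%MS.

(** Comparing coordinates in the eigenbasis shows that every eigenvector for rH,
    not only those among the rows of B, lies in the span. *)
Lemma eigenspanP (u : 'rV_m) :
  (u <= eigenspan)%MS <-> {in G, forall g, u *m rG g = rH g 0 0 *: u}.
Proof.
split=> [/sub_sumsmxP[w ->] g gG | uE].
  rewrite mulmx_suml scaler_sumr; apply: eq_bigr => i /asboolP ci.
  have /submxP[D ->] : (w i *m <<row i B>> <= row i B)%MS.
    by rewrite (submx_trans (submxMl _ _)) // genmxE.
  by rewrite -mulmxA B_eigen // ci // scalemxAr.
pose v := u *m invmx B.
have uv : u = \sum_i v 0 i *: row i B by rewrite -mulmx_sum_row mulmxKV.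
rewrite uv summx_sub // => i _.
have [ci | ci] := boolP (same_char i).
  by rewrite scalemx_sub // (sumsmx_sup i) // genmxE.
suff -> : v 0 i = 0 by rewrite scale0r sub0mx.
apply: contraNeq ci => vi; apply/asboolP => g gG; apply: (mulfI vi).
have : \row_j (v 0 j * c j g) *m B = (rH g 0 0 *: v) *m B.
  rewrite -scalemxAl mulmxKV // -uE // [in RHS]uv mulmx_suml mulmx_sum_row.
  by apply: eq_bigr => j _; rewrite -scalemxAl B_eigen // scalerA mxE.
move/(can_inj (mulmxK B_unit))/rowP/(_ i).
by rewrite !mxE => ->; rewrite mulrC.
Qed.

Lemma rank_eigenspan : \rank eigenspan = #|same_char|.
Proof.
rewrite rank_mxdirect_subsum; last exact: mxdirect_row_eigenbasis.
by under eq_bigr do rewrite genmxE rank_row_eigenbasis; rewrite sum1_card.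
Qed.

(** An eigenvector spans a nonzero submodule, so inside a simple module it spans
    everything. *)
Lemma mxsimple_eigenvector (U : 'M_m) (u : 'rV_m) :
  mxsimple rG U -> (u <= U)%MS -> (u <= eigenspan)%MS -> u != 0 ->
  (U :=: u)%MS.
Proof.
move=> [_ _ Umin] uU /eigenspanP uE u0.
apply/eqmxP; rewrite uU andbT -(genmxE u); apply: Umin.
- apply/mxmoduleP => g gG; rewrite (eqmxMr _ (genmxE _)) genmxE.
  by rewrite uE // scalemx_sub.
- by rewrite genmxE.
by rewrite -mxrank_eq0 genmxE mxrank_eq0.
Qed.

(** An isomorphism to rH pulls the eigenvector equation back to U; conversely a
    simple U inside the eigenspace is the line of any of its nonzero vectors. *)
Lemma mxsimple_rsimP (U : 'M_m) (simU : mxsimple rG U) :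
  mx_rsim (submod_repr (mxsimple_module simU)) rH <-> (U <= eigenspan)%MS.
Proof.
set modU := mxsimple_module simU; split.
  case=> A _ freeA AH; apply/row_subP => i; apply/eigenspanP => g gG.
  set u := row i U; have uU : (u <= U)%MS by exact: row_sub.
  have ugU : (u *m rG g <= U)%MS by exact: mxmodule_trans.
  rewrite -(in_submodK ugU) -[in RHS](in_submodK uU) -linearZ /=.
  congr (val_submod _); apply: (row_free_inj freeA).
  rewrite (in_submodJ modU) // -mulmxA AH // mulmxA.
  by rewrite -scalemxAl [in LHS](mx11_scalar (rH g)) mul_mx_scalar.
move=> UE; have rU1 : \rank U = 1%N.
  have u0 : nz_row U != 0 by apply: nz_row_mxsimple simU.
  have uU : (nz_row U <= U)%MS by exact: nz_row_sub.
  by rewrite (mxsimple_eigenvector simU uU) ?rank_rV ?u0 // (submx_trans uU).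
have UH : {in G, forall g, submod_repr modU g = (rH g 0 0)%:M}.
  move=> g gG; apply: (can_inj (@val_submodK _ _ _ _)).
  rewrite -[submod_repr modU g]mul1mx (val_submodJ modU) //.
  apply/row_matrixP => i; rewrite -[(rH g 0 0)%:M]scalemx1.
  rewrite row_mul [in RHS]linearZ /= [RHS]linearZ /=.
  apply: (iffLR (eigenspanP _)) => //.
  exact: submx_trans (submx_trans (row_sub i _) (val_submodP _)) UE.
move: (submod_repr modU) UH; rewrite rU1 => rU UH.
apply: (@MxReprSim _ _ _ _ rU _ rH 1%:M) => [//||g gG].
  by rewrite row_free_unit unitmx1.
by rewrite mulmx1 mul1mx UH // -mx11_scalar.
Qed.

(** Both sides are the dimension of the eigenspace of rH: the basis vectors with
    that character span it, and it is the direct sum of the simple summands it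
    contains, all of which are lines. *)
Theorem eigenbasis_multiplicity : has_multiplicity rG rH #|same_char|.
Proof.
split; first by split; exact: eigenbasis_semisimple.
move=> I U simU sumU dU; rewrite -rank_eigenspan.
pose A : pred I := fun i => (U i <= eigenspan)%MS.
have -> : count_similar rH simU = #|A|.
  by apply: eq_card => i; rewrite !inE; apply/asboolP/idP => /mxsimple_rsimP.
have rankA i : A i -> \rank (U i) = 1%N.
  by move=> /(mxsimple_rsimP (simU i))/mxrank_rsim.
rewrite -sum1_card -(eq_bigr _ rankA) -rank_mxdirect_subsum //.
apply/eqmx_rank/andP; split; first by apply/sumsmx_subP.
apply/rV_subP => u uE; have : (u <= \sum_i U i)%MS by rewrite sumU submx1.
case/sub_sumsmxP => D uD; rewrite uD; apply: summx_sub => i _.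
have wU j : (D j *m U j <= U j)%MS by exact: submxMl.
have wE j : (D j *m U j <= eigenspan)%MS.
  apply/eigenspanP => g gG; apply/eqP; rewrite -subr_eq0; apply/eqP.
  (* The defects w l of the components sum to the defect of u, which is 0. *)
  pose w l := D l *m U l *m rG g - rH g 0 0 *: (D l *m U l).
  rewrite -/(w j); apply: (mxdirect_sum_eq0 dU) => [l|]; rewrite /w.
    rewrite addmx_sub ?eqmx_opp ?scalemx_sub //.
    exact: mxmodule_trans (mxsimple_module (simU l)) gG (wU l).
  rewrite sumrB -mulmx_suml -scaler_sumr -uD.
  by rewrite (iffLR (eigenspanP u)) // subrr.
have [-> | w0] := eqVneq (D i *m U i) 0; first exact: sub0mx.
apply: (submx_trans (wU i)); rewrite (sumsmx_sup i) //.
by rewrite /A (mxsimple_eigenvector (simU i) (wU i)).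
Qed.

End EigenbasisMultiplicity.

(** * Monomial bases of homogeneous components *)

Section Monomials.

Variables (K : fieldType) (N d : nat).

Local Notation S := (homog_part N K d).

Definition exponents : seq 'X_{1..N} :=
  [seq bmnm m | m : 'X_{1..N < d.+1} <- enum {: 'X_{1..N < d.+1}}
              & mdeg m == d].

Lemma mem_exponents m : (m \in exponents) = (mdeg m == d).
Proof.
apply/mapP/eqP => [[m' + ->]|md]; first by rewrite mem_filter => /andP[/eqP].
have mlt : (mdeg m < d.+1)%N by rewrite md.
by exists (BMultinom mlt); rewrite // mem_filter /= md eqxx mem_enum.
Qed.

Lemma exponents_uniq : uniq exponents.
Proof.
rewrite map_inj_uniq; first exact: filter_uniq (enum_uniq _).
exact: (val_inj : injective (@bmnm N d.+1)).
Qed.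

(** Total in m, with the junk value 0 outside degree d, so that it can be mapped
    over sequences of exponents. *)
Definition monomial (m : 'X_{1..N}) : S :=
  insubd (0 : dhomog N K d) ('X_[m] : {mpoly K[N]}).

Lemma val_monomial m :
  m \in exponents -> val (monomial m) = 'X_[m] :> {mpoly K[N]}.
Proof. by rewrite mem_exponents => md; rewrite insubdK // dhomogX. Qed.

Definition monomials : seq S := map monomial exponents.

Lemma mcoeff_comb (a : 'X_{1..N} -> K) m :
  (val (\sum_(m' <- exponents) a m' *: monomial m'))@_m
    = if m \in exponents then a m else 0.
Proof.
rewrite raddf_sum /= raddf_sum /=.
transitivity (\sum_(m' <- exponents) a m' * (m' == m)%:R).
  rewrite !big_seq; apply: eq_bigr => m' m'd.
  by rewrite mcoeffZ val_monomial // mcoeffX.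
case: ifP => [md | mNd].
  rewrite (bigD1_seq m) ?exponents_uniq //= eqxx mulr1 big1 ?addr0 // => m'.
  by move=> /negPf ->; rewrite mulr0.
rewrite big_seq big1 // => m' m'd; case: eqP => [m'm|_]; last by rewrite mulr0.
by rewrite -m'm m'd in mNd.
Qed.

Lemma homog_comb (p : S) :
  p = \sum_(m <- exponents) (val p)@_m *: monomial m.
Proof.
apply/val_inj/mpolyP => m; rewrite mcoeff_comb mem_exponents.
case: ifPn => // md; apply: (@dhomog_nemf_coeff _ _ mdeg d) => //.
exact: dhomog_is_dhomog.
Qed.

Lemma monomials_free : free monomials.
Proof.
apply/(@freeP _ _ _ (in_tuple monomials)) => a a0 i.
(* Coefficients indexed by positions become coefficients indexed by
   exponents, the form needed for comparing coefficients. *)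
pose f m := if insub (index m exponents) is Some j then a j else 0.
have fE (j : 'I_(size monomials)) : f (nth 0%MM exponents j) = a j.
  rewrite /f index_uniq ?exponents_uniq -?(size_map monomial) //.
  by rewrite valK.
have := mcoeff_comb f (nth 0%MM exponents i).
rewrite mem_nth -?(size_map monomial) // fE => <-.
rewrite (big_nth 0%MM) -(size_map monomial) big_mkord.
rewrite (eq_bigr (fun j : 'I_(size monomials) => a j *: monomials`_j)).
  by rewrite a0 mcoeff0.
by move=> j _; rewrite fE (nth_map 0%MM) // -(size_map monomial).
Qed.

Lemma monomials_basis : basis_of {:S} monomials.
Proof.
apply/andP; split; last exact: monomials_free.
rewrite eqEsubv subvf; apply/subvP => p _; rewrite (homog_comb p).
rewrite big_seq memv_suml // => m md.
by rewrite memvZ // memv_span // map_f.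
Qed.

Definition mspan (P : pred 'X_{1..N}) : {vspace S} :=
  span (map monomial (filter P exponents)).

Lemma dim_mspan P : \dim (mspan P) = count P exponents.
Proof.
rewrite -size_filter -(size_map monomial); apply/eqP.
have := monomials_free.
have /perm_free -> : perm_eq monomials
  (map monomial (filter P exponents)
     ++ map monomial (filter (predC P) exponents)).
  by rewrite -map_cat perm_map // perm_sym perm_filterC.
by move/catl_free; rewrite /free.
Qed.

End Monomials.

(** * Weights and characters of the monomials *)

Section Weights.

Variables (K : fieldType) (k n : nat).

Local Notation N := (nvars k n).

Definition mweight (m : 'X_{1..N}) : lattice n := \sum_i wt i *+ m i.

Lemma mweight_sum d (t : 'I_d -> 'I_N) :
  mweight (\sum_i U_(t i))%MM = \sum_i wt (t i).
Proof.
rewrite /mweight.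
transitivity (\sum_i \sum_(j < d) wt i *+ (t j == i)).
  apply: eq_bigr => i _; rewrite mnm_sumE sumrMnr.
  by under eq_bigr do rewrite mnm1E.
rewrite exchange_big; apply: eq_bigr => j _ /=.
rewrite (bigD1 (t j)) //= eqxx big1 ?addr0 // => i.
by rewrite eq_sym => /negPf ->.
Qed.

Lemma exponentsP d m :
  reflect (exists t : {ffun 'I_d -> 'I_N}, m = (\sum_i U_(t i))%MM)
          (m \in exponents N d).
Proof.
rewrite mem_exponents; apply: (iffP eqP) => [md | [t ->]]; last first.
  rewrite mdeg_sum; under eq_bigr do rewrite mdeg1.
  by rewrite sum1_card card_ord.
have sz : size (m2s m) == d by rewrite size_m2s md.
exists [ffun i => tnth (Tuple sz) i].
under eq_bigr do rewrite ffunE.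
rewrite -[LHS]s2mK; apply/mnmP => j; rewrite mnmE mnm_sumE.
rewrite -[m2s m]/(val (Tuple sz)) -sum1_count big_tuple big_mkcond.
by apply: eq_bigr => i _; rewrite mnm1E /=; case: eqP.
Qed.

Lemma zprod_monomial d (t : {ffun 'I_d -> 'I_N}) :
  zprod K t = monomial K d (\sum_i U_(t i))%MM.
Proof.
apply: val_inj; rewrite val_monomial; last by apply/exponentsP; exists t.
by rewrite (big_morph (fun m => 'X_[K, m]) (@mpolyXD _ _) (@mpolyX0 _ _)).
Qed.

(** S_weight is spanned by products of variables indexed by words; reordering a
    word does not change its product, so only the exponents matter. *)
Lemma S_weight_mspan d v :
  S_weight K k d v = mspan K d [pred m | mweight m == v].
Proof.
apply: eq_span => p; apply/mapP/mapP => [[t + ->]|[m + ->]].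
  rewrite mem_enum inE => tv.
  exists (\sum_i U_(t i))%MM; last exact: zprod_monomial.
  rewrite mem_filter /= mweight_sum tv /=; apply/exponentsP.
  by exists t.
rewrite mem_filter => /andP[/= mv /exponentsP[t mt]]; exists t.
  by rewrite mem_enum inE -mweight_sum -mt.
by rewrite zprod_monomial mt.
Qed.

Lemma mweight_dI1 d m : m \in exponents N d -> mweight m \in dI1 k n d.
Proof.
case/exponentsP => t ->; rewrite mweight_sum /dI1.
elim: d t => [|d IHd] t /=; first by rewrite big_ord0 inE.
rewrite big_ord_recl; apply/imfset2P; exists (wt (t ord0)).
  exact: fsvalP.
exists (\sum_(i < d) wt ([ffun j => t (lift ord0 j)] i)); first exact: IHd.
by congr (_ + _); apply: eq_bigr => i _; rewrite ffunE.
Qed.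

(** The label of the character by which H acts on a degree-d monomial of weight
    v; the shift by d records the dx of each factor. *)
Definition residue d (v : lattice n) : Hgroup k n :=
  ((v.1 + d%:Z)%:~R, \row_j (- v.2 0 j)%:~R).

Lemma sum_count_fibers (T V : eqType) (f : T -> V) (s : seq T) (r : seq V) :
  uniq r ->
  (\sum_(v <- r) count [pred x | f x == v] s = count [pred x | f x \in r] s)%N.
Proof.
move=> ur; elim: s => [|x s IHs]; first by rewrite big1.
rewrite /= big_split /= IHs; congr (_ + _)%N.
rewrite -(count_uniq_mem _ ur) -[RHS]sum1_count [RHS]big_mkcond.
apply: eq_bigr => v _.
by rewrite /= eq_sym; case: eqP.
Qed.

(** The weight of a degree-d monomial lies in the d-fold Minkowski sum
    automatically, so membership in J is the congruence alone. *)
Lemma sum_dim_J d (h : Hgroup k n) :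
  (\sum_(v <- J d h) \dim (S_weight K k d v))%N =
  count [pred m | residue d (mweight m) == h] (exponents N d).
Proof.
under eq_bigr do rewrite S_weight_mspan dim_mspan.
rewrite sum_count_fibers ?fset_uniq //; apply: eq_in_count => m md /=.
rewrite !inE /= (mweight_dI1 md) /= -pair_eqE /=; congr (_ && _).
apply/forallP/eqP => [E | <- j]; last by rewrite mxE.
by apply/rowP => j; rewrite mxE; apply/eqP.
Qed.

Variables (zeta : K) (hk : (1 < k)%N) (hzeta : k.-primitive_root zeta).

(** Evaluating at the standard generators of H gives the powers of zeta whose
    exponents are the entries of h. *)
Lemma chi_inj (h h' : Hgroup k n) : chi zeta h =1 chi zeta h' -> h = h'.
Proof.
have zpow_inj : injective (@zpow K k zeta).
  move=> x y /eqP; rewrite /zpow (eq_prim_root_expr hzeta).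
  have lt (z : 'Z_k) : (z < k)%N by rewrite -[X in (_ < X)%N](Zp_cast hk).
  by rewrite !modn_small // => /eqP/val_inj.
move=> E; case: h h' E => [h1 h] [h1' h'] E; congr pair.
  have /zpow_inj := E (1, 0); rewrite /= !dotk0r // !addr0 !mulr1.
  exact.
apply/rowP => j; have /zpow_inj := E (0, delta_mx 0 j).
have dotd (a : 'rV['Z_k]_n.-1) : dotk a (delta_mx 0 j) = a 0 j.
  rewrite /dotk (bigD1 j) //= mxE !eqxx mulr1 big1 ?addr0 // => i ij.
  by rewrite mxE (negPf ij) andbF mulr0.
by rewrite /= !mulr0 !add0r !dotd.
Qed.

Lemma chiDl (h h' e : Hgroup k n) :
  chi zeta (h + h') e = chi zeta h e * chi zeta h' e.
Proof.
rewrite /chi -zpowD // mulrDl addrACA; congr (zpow _ (_ + _)).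
by rewrite /dotk -big_split; apply: eq_bigr => j _; rewrite mxE mulrDl.
Qed.

Lemma chi0l (e : Hgroup k n) : chi zeta 0 e = 1.
Proof.
rewrite /chi mul0r add0r /dotk big1 => [|j _]; first by [].
by rewrite mxE mul0r.
Qed.

Lemma sigma_coef_chi e (v : lattice n) :
  sigma_coef zeta e v = chi zeta (residue 1 v) e.
Proof.
rewrite /sigma_coef /chi mulrC; congr (zpow _ (_ + _)).
rewrite /dotk -sumrN; apply: eq_bigr => j _.
by rewrite !mxE mulrNz mulNr.
Qed.

Lemma residue0 : residue 0 0 = 0.
Proof. by congr pair; apply/rowP => j; rewrite !mxE oppr0. Qed.

(** Degrees must be added together with weights: this is what makes the
    character of a product the product of the characters. *)
Lemma residueD d d' v v' :
  residue (d + d') (v + v') = residue d v + residue d' v'.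
Proof.
congr pair; first by rewrite /= -intrD PoszD addrACA.
by apply/rowP => j; rewrite !mxE -intrD opprD.
Qed.

Lemma prod_sigma_coef e d m : m \in exponents N d ->
  \prod_i sigma_coef zeta e (wt i) ^+ m i = chi zeta (residue d (mweight m)) e.
Proof.
rewrite mem_exponents => /eqP <-; rewrite mdegE /mweight.
elim/big_rec3: _ => [|i x v c _ ->].
  by rewrite residue0 chi0l.
rewrite residueD chiDl; congr (_ * _).
elim: (m i) => [|r IHr]; first by rewrite expr0 mulr0n residue0 chi0l.
by rewrite exprS mulrS -[r.+1]add1n residueD chiDl IHr sigma_coef_chi.
Qed.

Lemma sigma_monomial e d m : m \in exponents N d ->
  sigma_deg zeta e (monomial K d m) =
    chi zeta (residue d (mweight m)) e *: monomial K d m.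
Proof.
move=> md; apply/val_inj/mpolyP => m'.
rewrite /= mcoeff_sigma mcoeffZ val_monomial // mcoeffX.
case: eqP => [<- | _]; last by rewrite !mulr0.
by rewrite (prod_sigma_coef e md).
Qed.

Theorem S_repr_multiplicity d h :
  has_multiplicity (S_repr n hk hzeta d) (chi_repr hk hzeta h)
    (count [pred m | residue d (mweight m) == h] (exponents N d)).
Proof.
pose D := \dim {: S_ K k n d}; pose b := vbasis {: S_ K k n d}.
have bP : basis_of {: S_ K k n d} b by exact: vbasisP.
have X_basis := monomials_basis K N d.
have szX : size (monomials K N d) == D.
  by rewrite -(eqP (basis_free X_basis)) (span_basis X_basis).
have szE : size (exponents N d) = D by rewrite -(eqP szX) [RHS]size_map.
pose x (i : 'I_D) := nth 0%MM (exponents N d) i.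
have xd i : x i \in exponents N d by rewrite mem_nth // szE.
pose B := \matrix_i rVof b (monomial K d (x i)).
pose c i e := chi zeta (residue d (mweight (x i))) e.
have B_unit : B \in unitmx.
  rewrite (_ : B = \matrix_i rVof b (Tuple szX)`_i).
    exact: (@basis_matrix_unit _ _ b (Tuple szX) bP X_basis).
  by apply/row_matrixP => i; rewrite !rowK /= (nth_map 0%MM) // szE.
have B_eigen i : {in [set: Hgroup k n], forall e,
    row i B *m S_repr n hk hzeta d e = c i e *: row i B}.
  move=> e _; rewrite rowK /= -rVof_app //.
  by rewrite lfunE /= sigma_monomial // linearZ.
have := eigenbasis_multiplicity B_unit B_eigen (chi_repr hk hzeta h).
congr has_multiplicity.
rewrite -sum1_count (big_nth 0%MM) szE big_mkord -sum1_card.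
apply: eq_bigl => i; apply/asboolP/eqP => [E | E e _].
  by apply: chi_inj => e; rewrite -/(c i e) E ?inE //= mxE.
by rewrite /c /x E /= mxE.
Qed.

End Weights.

Theorem proposition8 (K : closedFieldType) (k n : nat)
  (hk : (2 <= k)%N) (hn : (2 <= n)%N)
  (hchar : forall p : nat, p \in [pchar K] -> ~~ (p %| k)%N)
  (lam : nat -> K)
  (hlam1 : lam 1%N = 1)
  (hlam01 : forall i : nat, (2 <= i <= n.-1)%N -> lam i != 0 /\ lam i != 1)
  (hlam_inj : forall i j : nat, (2 <= i <= n.-1)%N -> (2 <= j <= n.-1)%N ->
     lam i = lam j -> i = j)
  (zeta : K) (hzeta : k.-primitive_root zeta)
  (hgenus : (2 < (n - 1) * (k - 1))%N)
  (hntrig : ~ trigonal (fermat_curve k n lam))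
  (hnquint : ~ plane_quintic (fermat_curve k n lam))
  (d : nat) (hd : (1 <= d)%N) (h : 'Z_k * 'rV['Z_k]_n.-1) :
  has_multiplicity (S_repr n hk hzeta d) (chi_repr hk hzeta h)
    (\sum_(v <- J d h) \dim (S_weight K k d v))%N.
Proof.
rewrite sum_dim_J; exact: S_repr_multiplicity.
Qed.
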